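(* Let $\beta>0$. There is no constant $C>0$ such that $$\big\|T_{\chi_A}(\chi_{E_1},\chi_{E_2})\big\|_{1/(1+\beta),\infty}\leq C\,|E_1|\,|E_2|\,|A|^\beta$$ for all measurable sets $E_1,E_2,A\subseteq\mathbb{R}$ of finite measure.
   Context: For nonnegative measurable functions $f_1,f_2,g$ on $\mathbb{R}$, $$T_g(f_1,f_2)(x)=\int_{\mathbb{R}}f_1(x+y)\,f_2(x-y)\,g(y)\,dy,\qquad x\in\mathbb{R}.$$ $\chi_E$ is the characteristic function of $E$ and $|E|$ is the Lebesgue measure of $E$. For $0<p<\infty$, the weak $L^p$ quasi-norm is $\|f\|_{p,\infty}=\sup_{t>0}t^{1/p}f^*(t)=\sup_{\lambda>0}\lambda\,|\{|f|>\lambda\}|^{1/p}$, where $f^*$ is the decreasing rearrangement of $f$. *)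

(* Defs.v *)
From mathcomp Require Import all_boot all_order all_algebra.
From mathcomp Require Import all_classical all_reals all_analysis.
Import Order.TTheory GRing.Theory Num.Theory.
Import numFieldNormedType.Exports.

Set Implicit Arguments.
Unset Strict Implicit.
Unset Printing Implicit Defensive.

Local Open Scope classical_set_scope.
Local Open Scope ring_scope.

(* Extended-real valued: the integral of a nonnegative function may be +oo. *)
Definition trilinT (R : realType) (g f1 f2 : R -> R) (x : R) : \bar R :=
  (\int[@lebesgue_measure R]_y (f1 (x + y) * f2 (x - y) * g y)%:E)%E.

(* The weak L^p quasi-norm through the distribution function:
   sup_{l > 0} l |{|f| > l}|^{1/p}, for 0 < p < oo. *)
Definition weakLnorm (R : realType) (p : R) (f : R -> \bar R) : \bar R :=
  ereal_sup [set (l%:E *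
    (@lebesgue_measure R [set x : R | l%:E < `|f x|]) `^ (p^-1))%E
    | l in [set l : R | 0 < l]].

(* Main.v *)
Require Import Defs.
From mathcomp Require Import all_boot all_order all_algebra.
From mathcomp Require Import all_classical all_reals all_analysis.
From mathcomp Require Import measurable_realfun zify ring lra.
Import Order.TTheory GRing.Theory Num.Theory.
Import numFieldNormedType.Exports.

Local Open Scope classical_set_scope.
Local Open Scope ring_scope.

(** The inequality is tested on thickened finite sets of integers.  If [P],
    [Q] and [G] are finite, let [E1], [E2], [A] be small neighbourhoods of
    [2P], [2Q] and [G].  For x near u + v and y near u - v, with u in [P] and
    v in [Q], the point x + y is near 2u and x - y is near 2v; so
    T_A(E1, E2) is bounded below near every sum u + v whose difference u - v
    lies in [G] ([size_le_measure_level]).  If [S] is a set of such sums, the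
    conjectured bound becomes, up to constants,
      |S|^(1+beta) <= C' |P| |Q| |G|^beta   ([weak_type_discretized]).
    To violate it, [S] must be almost as large as |P| |Q| while [G] is much
    smaller than [S].

    A mild violation comes from a Sidon set [P] with N elements and Q = -P: the
    N(N-1) sums s_i - s_j with i <> j are distinct, whereas the differences
    s_i + s_j are symmetric in i and j and so take only half as many values
    ([sum_dominant_sidon]).  The quotient of |S|^(1+beta) by
    |P| |Q| |G|^beta is then (1 - 1/N) 2^beta, which exceeds 1 as soon as N is
    large.  All four cardinalities are multiplicative under direct products,
    and a product can be embedded in the integers by writing its elements in a
    large base ([sum_dominantM]); so the k-th power of the example violates the
    inequality by the factor ((1 - 1/N) 2^beta)^k, which no constant can
    absorb ([large_power_ratio]). *)

(** * Configurations with many sums and few differences *)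

(** The cardinalities are parameters because they are all that survives in the
    discretised inequality.  Only [S] has to be duplicate-free: its size is used
    as a lower bound for a measure, those of [P], [Q] and [G] as upper
    bounds. *)
Definition sum_dominant (n m t : nat) (P Q G S : seq int) : Prop :=
  [/\ size P = n, size Q = n, size G = t, size S = m & uniq S] /\
  forall z, z \in S ->
    exists u v, [/\ u \in P, v \in Q, u + v = z & u - v \in G].

(** Uniqueness of expansions in base 2L, with signed digits of absolute value
    less than L. *)
Lemma digits_inj {L z t z' t' : int} :
  `|z| < L -> `|t| < L ->
  z + 2 * L * z' = t + 2 * L * t' -> z = t /\ z' = t'.
Proof.
move=> zL tL E; have z't' : z' = t'.
  by case: (ltgtP z' t') => // h; exfalso; nia.
by split=> //; move: E; rewrite z't'; lia.
Qed.

Lemma seq_int_bounded (s : seq int) :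
  exists2 L : int, 0 < L & forall z, z \in s -> `|z| < L.
Proof.
elim: s => [|a s [L L0 HL]]; first by exists 1.
exists (`|a| + L) => [|z]; first lia.
by rewrite inE => /orP[/eqP->|/HL]; lia.
Qed.

(** The direct product of two configurations, embedded in the integers through
    (x, y) |-> x + 2Ly.  This map is additive, hence respects sums and
    differences, and for L large it is injective on the product of the sets of
    sums. *)
Lemma sum_dominantM n m t n' m' t' P Q G S P' Q' G' S' :
  sum_dominant n m t P Q G S -> sum_dominant n' m' t' P' Q' G' S' ->
  exists P2 Q2 G2 S2,
    sum_dominant (n * n') (m * m') (t * t') P2 Q2 G2 S2.
Proof.
move=> [[sP sQ sG sS uS] H] [[sP' sQ' sG' sS' uS'] H'].
have [L L0 HL] := seq_int_bounded S.
pose f (x y : int) := x + 2 * L * y.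
exists (allpairs f P P'), (allpairs f Q Q'), (allpairs f G G'), (allpairs f S S').
split; first split; rewrite ?size_allpairs ?sP ?sQ ?sG ?sS ?sP' ?sQ' ?sG' ?sS' //.
  apply: allpairs_uniq => // -[z z'] [w w'] /allpairsP[[a b] /= [aS _ [-> ->]]].
  case/allpairsP=> -[c d] /= [cS _ [-> ->]] E.
  by have [-> ->] := digits_inj (HL _ aS) (HL _ cS) E.
move=> _ /allpairsP[[z z'] /= [/H[u [v [uP vQ uvz uvG]]] /H'[u' [v' [uP' vQ' uvz' uvG']]] ->]].
exists (f u u'), (f v v'); split; try exact: allpairs_f.
  by rewrite /f -uvz -uvz'; ring.
have -> : f u u' - f v v' = f (u - v) (u' - v') by rewrite /f; ring.
exact: allpairs_f.
Qed.

Lemma sum_dominantX n m t P Q G S (k : nat) :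
  sum_dominant n m t P Q G S ->
  exists P' Q' G' S', sum_dominant (n ^ k) (m ^ k) (t ^ k) P' Q' G' S'.
Proof.
move=> H; elim: k => [|k [P' [Q' [G' [S' IH]]]]].
  exists [:: 0], [:: 0], [:: 0], [:: 0]; split => // z.
  by rewrite inE => /eqP->; exists 0, 0.
by rewrite !expnS; exact: sum_dominantM H IH.
Qed.

(** The Sidon set consists of the points (i, i^2) of a parabola, again embedded
    in the integers: for i <> j, the values of i - j and i^2 - j^2 give i + j,
    hence the pair (i, j). *)
Lemma sum_dominant_sidon (N : nat) :
  exists P Q G S, sum_dominant N (N * N.-1) 'C(N, 2) P Q G S.
Proof.
pose s (i : nat) : int := i%:Z + 2 * N%:Z * i%:Z ^+ 2.
(* T lists the pairs j < i; each gives two sums but one difference. *)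
pose T := [seq (i, j) | i <- iota 0 N, j <- iota 0 i].
have memT i j : ((i, j) \in T) = (j < i < N)%N.
  apply/allpairsPdep/idP => [[a [b []]]|/andP[ji iN]].
    by rewrite !mem_iota => /= aN ba [-> ->]; rewrite ba aN.
  by exists i, j; rewrite !mem_iota.
have sizeT : size T = 'C(N, 2).
  rewrite size_allpairs_dep sumnE big_map -bin2_sum -{1}(subn0 N).
  by apply: eq_bigr => i _; rewrite size_iota.
have uniqT : uniq T.
  apply: allpairs_uniq_dep; [exact: iota_uniq|by move=> *; exact: iota_uniq|].
  by move=> [a b] [c d] _ _ /= [-> ->].
have s_inj i j k l : (j < N)%N -> (i < N)%N -> (k < N)%N -> (l < N)%N ->
    i != j -> s i - s j = s k - s l -> i = k /\ j = l.
  move=> jN iN kN lN ij E.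
  have [] : i%:Z - j%:Z = k%:Z - l%:Z /\ i%:Z ^+ 2 - j%:Z ^+ 2 = k%:Z ^+ 2 - l%:Z ^+ 2.
    apply: (digits_inj (L := N%:Z)); [lia|lia|].
    by move: E; rewrite /s => E; lia.
  by nia.
exists [seq s i | i <- iota 0 N], [seq - s i | i <- iota 0 N],
  [seq s x.1 + s x.2 | x <- T],
  ([seq s x.1 - s x.2 | x <- T] ++ [seq s x.2 - s x.1 | x <- T]).
split; first split; rewrite ?size_map ?size_iota //.
- by rewrite size_cat !size_map sizeT addnn -mul2n -(mul_bin_diag N 1) bin1.
- rewrite cat_uniq !map_inj_in_uniq ?uniqT /=.
  + rewrite andbT; apply/hasPn => _ /mapP[[i j] ijT ->].
    apply/mapP => -[[k l] klT /=]; move: ijT klT; rewrite !memT => ijT klT.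
    by case/s_inj; lia.
  + move=> [i j] [k l]; rewrite !memT => ijT klT /= /s_inj[]; try lia.
    by move=> -> ->.
  + move=> [i j] [k l]; rewrite !memT => ijT klT /= /s_inj[]; try lia.
    by move=> -> ->.
move=> z; rewrite mem_cat => /orP[] /mapP[[i j] ijT ->] /=;
  have := ijT; rewrite memT => /andP[ji iN].
- exists (s i), (- s j); rewrite opprK; split=> //.
  + by apply: map_f; rewrite mem_iota.
  + by apply: (map_f (fun i => - s i)); rewrite mem_iota /=; lia.
  + exact: (map_f (fun x => s x.1 + s x.2) ijT).
- exists (s j), (- s i); rewrite opprK; split=> //.
  + by apply: map_f; rewrite mem_iota /=; lia.
  + by apply: (map_f (fun i => - s i)); rewrite mem_iota /=; lia.
  + by rewrite addrC; exact: (map_f (fun x => s x.1 + s x.2) ijT).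
Qed.

(** * Thickened sets of integers *)

Definition thicken {R : realType} (r : R) (s : seq int) : set R :=
  [set x | exists2 z, z \in s & `|x - z%:~R| <= r].

Lemma thicken_cons {R : realType} (r : R) z s :
  thicken r (z :: s) = [set` `[z%:~R - r, z%:~R + r]] `|` thicken r s.
Proof.
apply/seteqP; split=> x /=; rewrite in_itv /=.
  move=> [w]; rewrite inE => /orP[/eqP->|ws] h; last by right; exists w.
  by left; move: h; rewrite ler_norml => /andP[? ?]; apply/andP; split; lra.
move=> [/andP[h1 h2]|[w ws h]]; last by exists w => //; rewrite inE ws orbT.
by exists z; rewrite ?mem_head // ler_norml; apply/andP; split; lra.
Qed.

Lemma thicken_nil {R : realType} (r : R) : thicken r [::] = set0.
Proof. by apply/seteqP; split=> // x []. Qed.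

Lemma measurable_thicken {R : realType} (r : R) s : measurable (thicken r s).
Proof.
elim: s => [|z s IH]; first by rewrite thicken_nil.
by rewrite thicken_cons; apply: measurableU.
Qed.

Lemma lebesgue_measure_interval {R : realType} (c r : R) : 0 < r ->
  @lebesgue_measure R [set` `[c - r, c + r]] = (2 * r)%:E.
Proof.
by move=> r0; rewrite lebesgue_measure_itv /= lte_fin ifT; [congr EFin; ring|lra].
Qed.

Lemma le_measure_thicken {R : realType} (r : R) s : 0 < r ->
  (@lebesgue_measure R (thicken r s) <= (2 * r * (size s)%:R)%:E)%E.
Proof.
move=> r0; elim: s => [|z s IH]; first by rewrite thicken_nil measure0 mulr0.
rewrite thicken_cons.
have := measureU2 (@lebesgue_measure R) (measurable_itv `[z%:~R - r, z%:~R + r])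
  (measurable_thicken r s).
move=> /le_trans; apply.
rewrite [X in (X + _)%E](lebesgue_measure_interval _ _ r0).
by rewrite /= -[(size s).+1%:R]natr1 mulrDr mulr1 addrC EFinD leeD2r.
Qed.

(** Distinct integers are at distance at least 1, so for r < 1/2 the intervals
    are disjoint. *)
Lemma measure_thicken {R : realType} (r : R) s : 0 < r -> r < 1 / 2 -> uniq s ->
  @lebesgue_measure R (thicken r s) = (2 * r * (size s)%:R)%:E.
Proof.
move=> r0 r1; elim: s => [|z s IH] /=.
  by rewrite thicken_nil measure0 mulr0.
move=> /andP[zs us].
have disj : [set` `[z%:~R - r, z%:~R + r]] `&` thicken r s = set0.
  apply/seteqP; split=> // x [/=]; rewrite in_itv /= => /andP[h1 h2] [w ws].
  rewrite ler_norml => /andP[h3 h4].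
  have : `|z%:~R - w%:~R : R| < 1 by rewrite ltr_norml; apply/andP; split; lra.
  rewrite -intrB -intr_norm ltrz1 => h.
  by have zw : z = w by [lia]; move: zs; rewrite zw ws.
rewrite thicken_cons (measureU (@lebesgue_measure R) (measurable_itv _)
  (measurable_thicken r s) disj).
rewrite [X in (X + _)%E](lebesgue_measure_interval _ _ r0) [X in (_ + X)%E]IH //.
by rewrite -[(size s).+1%:R]natr1 mulrDr mulr1 addrC EFinD.
Qed.

Lemma measurable_incidence {R : realType} (E1 E2 A : set R) :
  measurable E1 -> measurable E2 -> measurable A ->
  measurable [set z : R * R | [/\ E1 (z.1 + z.2), E2 (z.1 - z.2) & A z.2]].
Proof.
move=> m1 m2 mA.
have mD : measurable_fun setT (fun z : R * R => z.1 + z.2).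
  exact: measurable_funD measurable_fst measurable_snd.
have mB : measurable_fun setT (fun z : R * R => z.1 - z.2).
  exact: measurable_funB measurable_fst measurable_snd.
have := measurableI _ _ (mD measurableT _ m1)
          (measurableI _ _ (mB measurableT _ m2)
             (@measurable_snd _ _ R R measurableT _ mA)).
rewrite !setTI; congr measurable.
by apply/seteqP; split=> z /=; [case=> ? []|case].
Qed.

(** As the measure of a section of a planar set, T_A(E1, E2)(x) is measurable
    in x; this makes its level sets measurable. *)
Lemma trilinT_indic {R : realType} (E1 E2 A : set R) (x : R) :
  measurable E1 -> measurable E2 -> measurable A ->
  trilinT (\1_A : R -> R) (\1_E1 : R -> R) (\1_E2 : R -> R) x =
  @lebesgue_measure R
    (xsection [set z | [/\ E1 (z.1 + z.2), E2 (z.1 - z.2) & A z.2]] x).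
Proof.
move=> m1 m2 mA.
rewrite /trilinT.
rewrite -[X in lebesgue_measure X]setIT -integral_indic //; last first.
  by apply: measurable_xsection; exact: measurable_incidence.
apply: eq_integral => y _; congr EFin; rewrite !indicE -!natrM !mulnb.
congr ((nat_of_bool _)%:R); rewrite [RHS](_ : _ = ((x, y) \in
  [set z : R * R | [/\ E1 (z.1 + z.2), E2 (z.1 - z.2) & A z.2]])).
  apply/idP/idP => [/andP[/andP[/set_mem ? /set_mem ?] /set_mem ?]|/set_mem[? ? ?]].
    exact: mem_set.
  by rewrite !mem_set.
by apply/idP/idP => [/set_mem|] // ?; exact: mem_set.
Qed.

Lemma measurable_trilinT_indic {R : realType} (E1 E2 A : set R) :
  measurable E1 -> measurable E2 -> measurable A ->
  measurable_fun setT
    (trilinT (\1_A : R -> R) (\1_E1 : R -> R) (\1_E2 : R -> R)).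
Proof.
move=> m1 m2 mA.
have /funext -> := fun x => trilinT_indic E1 E2 A x m1 m2 mA.
by apply: measurable_fun_xsection; exact: measurable_incidence.
Qed.

(** The radii 1/2 for [E1], [E2] and 1/4 for [A] fit together: if x and y are
    within 1/4 of u + v and u - v, then x + y and x - y are within 1/2 of 2u and
    2v.  So T >= 1/2 > 1/4 on the disjoint intervals of length 1/2 around the
    elements of [S]. *)
Lemma size_le_measure_level {R : realType} n m t (P Q G S : seq int) :
  sum_dominant n m t P Q G S ->
  ((m%:R / 2)%:E <= @lebesgue_measure R
    [set x | ((4^-1)%R%:E < `|trilinT (\1_(thicken 4^-1%R G) : R -> R)
       (\1_(thicken 2^-1%R [seq (2 * u)%R | u <- P]) : R -> R)
       (\1_(thicken 2^-1%R [seq (2 * v)%R | v <- Q]) : R -> R) x|)%E])%E.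
Proof.
move=> [[_ _ _ <- uS] H].
have mG := @measurable_thicken R 4^-1 G.
have mP := @measurable_thicken R 2^-1 [seq 2 * u | u <- P].
have mQ := @measurable_thicken R 2^-1 [seq 2 * v | v <- Q].
have -> : (((size S)%:R / 2)%:E : \bar R) = @lebesgue_measure R (thicken 4^-1 S).
  by rewrite measure_thicken //; [congr EFin; field|lra].
apply: le_measure; rewrite ?inE.
- exact: measurable_thicken.
- rewrite -[X in measurable X]setTI; apply: emeasurable_fun_o_infty => //.
  apply: measurableT_comp => //; exact: measurable_trilinT_indic.
move=> x [z /H[u [v [uP vQ <- uvG]]]] /= hx.
apply: (@lt_le_trans _ _ (2 * 4^-1)%:E); first by rewrite lte_fin; lra.
apply: le_trans (lee_abs _); rewrite trilinT_indic //.
rewrite -(lebesgue_measure_interval (u - v)%:~R) //.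
apply: le_measure; rewrite ?inE; first exact: measurable_itv.
  by apply: measurable_xsection; exact: measurable_incidence.
move=> y; rewrite /= in_itv /xsection /= => /andP[h1 h2].
move: hx; rewrite ler_norml intrD => /andP[h3 h4]; rewrite intrB in h1 h2.
rewrite inE; split => /=.
- exists (2 * u); first exact: map_f.
  by rewrite ler_norml intrM; apply/andP; split; lra.
- exists (2 * v); first exact: map_f.
  by rewrite ler_norml intrM; apply/andP; split; lra.
- exists (u - v) => //.
  by rewrite ler_norml intrB; apply/andP; split; lra.
Qed.

Definition weak_type_bound {R : realType} (beta C : R) : Prop :=
  forall E1 E2 A : set R,
    measurable E1 -> measurable E2 -> measurable A ->
    (@lebesgue_measure R E1 < +oo)%E ->
    (@lebesgue_measure R E2 < +oo)%E ->
    (@lebesgue_measure R A < +oo)%E ->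
    (weakLnorm (1 / (1 + beta))
        (trilinT (\1_A : R -> R) (\1_E1 : R -> R) (\1_E2 : R -> R))
      <= C%:E * @lebesgue_measure R E1 * @lebesgue_measure R E2
         * (@lebesgue_measure R A) `^ beta)%E.

(** The level l = 1/4 of the weak quasi-norm, whose exponent 1 / (1 + beta)
    turns into the power 1 + beta of the measure of the level set. *)
Lemma weak_type_discretized {R : realType} (beta C : R) n m t (P Q G S : seq int) :
  0 < beta -> 0 < C ->
  weak_type_bound beta C ->
  sum_dominant n m t P Q G S ->
  4^-1 * (m%:R / 2) `^ (1 + beta) <= C * n%:R * n%:R * (t%:R / 2) `^ beta.
Proof.
move=> b0 C0 wt dom; have [[sP sQ sG _ _] _] := dom.
have vol2 s : (@lebesgue_measure R (thicken 2^-1%R [seq (2 * u)%R | u <- s])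
    <= (size s)%:R%:E)%E.
  by apply: le_trans (le_measure_thicken _ _ _) _; rewrite // size_map lee_fin; lra.
have vol4 : (@lebesgue_measure R (thicken 4^-1%R G) <= ((size G)%:R / 2)%R%:E)%E.
  by apply: le_trans (le_measure_thicken _ _ _) _; rewrite // lee_fin; lra.
rewrite -{1}sP -sQ -sG -lee_fin.
have := wt _ _ _ (measurable_thicken 2^-1 [seq 2 * u | u <- P])
  (measurable_thicken 2^-1 [seq 2 * v | v <- Q]) (measurable_thicken 4^-1 G)
  (le_lt_trans (vol2 P) (ltry _)) (le_lt_trans (vol2 Q) (ltry _))
  (le_lt_trans vol4 (ltry _)).
set T := trilinT _ _ _ => wtE.
apply: (@le_trans _ _ (weakLnorm (1 / (1 + beta)) T)).
  apply: le_trans (ereal_sup_ubound _); last by exists 4^-1 => //=.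
  rewrite div1r invrK EFinM -poweR_EFin; apply: lee_wpmul2l => //.
  apply: gt0_ler_poweR; rewrite ?in_itv /= ?leey ?andbT ?lee_fin //; [lra|].
  exact: size_le_measure_level dom.
apply: (le_trans wtE); rewrite !EFinM -poweR_EFin.
apply: lee_pmul; rewrite ?poweR_ge0 // ?mule_ge0 // ?lee_fin ?(ltW C0) //.
  apply: lee_pmul => //; first by rewrite mule_ge0 // lee_fin ltW.
  by apply: lee_pmul => //; rewrite lee_fin ltW.
by apply: gt0_ler_poweR; rewrite ?in_itv /= ?leey ?andbT // ?lee_fin // ltW.
Qed.

(** * Failure of the bound *)

Lemma powers_unbounded {R : realType} (q M : R) : 1 < q -> exists k, M < q ^+ k.
Proof.
move=> q1; have bern k : 1 + k%:R * (q - 1) <= q ^+ k.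
  elim: k => [|k IH]; first by rewrite mul0r addr0.
  have k0 : 0 <= k%:R * (q - 1) ^+ 2 by rewrite mulr_ge0 ?sqr_ge0.
  rewrite exprS -natr1; nra.
exists (Num.bound (M / (q - 1))); apply: lt_le_trans (bern _).
have := unstable.ltr_bound (M / (q - 1)); rewrite ltr_pdivrMr; lra.
Qed.

(** With a = 2^beta > 1, the ratio of the two sides is ((N - 1) a / N)^k up to
    the factor 8C; fix N with (N - 1) a > N, then take k large. *)
Lemma large_power_ratio {R : realType} (beta C : R) : 0 < beta ->
  exists N k : nat, (1 < N)%N /\
    8 * C * (N ^ k)%:R * (N ^ k)%:R < ((N * N.-1) ^ k)%:R * (2 ^+ k) `^ beta :> R.
Proof.
move=> b0; pose a : R := 2 `^ beta.
have a1 : 1 < a.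
  have := gt0_ltr_powR b0 (_ : 1 \in Num.nneg) (_ : 2 \in Num.nneg).
  by rewrite powR1; apply; rewrite ?nnegrE // ltr1n.
pose N := (Num.bound (a / (a - 1))).+2.
have aN : N%:R < N.-1%:R * a.
  have := unstable.ltr_bound (a / (a - 1)); rewrite /N /= -!natr1 ltr_pdivrMr; nra.
have N0 : 0 < N%:R :> R by rewrite ltr0n.
have q1 : 1 < N.-1%:R * a / N%:R by rewrite ltr_pdivlMr // mul1r.
have [k] := powers_unbounded _ (8 * C) q1.
rewrite expr_div_n exprMn; move=> hk.
exists N, k; split=> //.
have -> : (2 ^+ k) `^ beta = a ^+ k :> R.
  by rewrite -powR_mulrn // -powRrM mulrC powRrM powR_mulrn // powR_ge0.
rewrite expnMn !natrM !natrX -/N.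
have Nk : 0 < N%:R ^+ k :> R by rewrite exprn_gt0.
by move: hk; rewrite ltr_pdivlMr // => hk; nra.
Qed.

Theorem theorem2p4 (R : realType) (beta : R) (hbeta : 0 < beta) :
  ~ exists C : R, 0 < C /\
    forall E1 E2 A : set R,
      measurable E1 -> measurable E2 -> measurable A ->
      (@lebesgue_measure R E1 < +oo)%E ->
      (@lebesgue_measure R E2 < +oo)%E ->
      (@lebesgue_measure R A < +oo)%E ->
      (weakLnorm (1 / (1 + beta)) (trilinT (\1_A : R -> R) (\1_E1 : R -> R) (\1_E2 : R -> R))
        <= C%:E * @lebesgue_measure R E1 * @lebesgue_measure R E2
           * (@lebesgue_measure R A) `^ beta)%E.
Proof.
move=> [C [C0 wt]].
have [N [k [N1 large]]] := large_power_ratio beta C hbeta.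
have [P0 [Q0 [G0 [S0 dom0]]]] := sum_dominant_sidon N.
have [P [Q [G [S dom]]]] := sum_dominantX _ _ _ _ _ _ _ k dom0.
have := weak_type_discretized _ _ _ _ _ _ _ _ _ hbeta C0 wt dom.
(* Both sides contain the power beta of X = |G| / 2, because |S| = 2^k |G|. *)
set X := ('C(N, 2) ^ k)%:R / 2.
have X0 : 0 < X by rewrite divr_gt0 // ltr0n expn_gt0 bin_gt0 N1.
have -> : ((N * N.-1) ^ k)%:R / 2 = 2 ^+ k * X :> R.
  rewrite -[in LHS](bin1 N.-1) mul_bin_diag expnMn natrM natrX /X; by ring.
have Y0 : 0 < 2 ^+ k * X by rewrite mulr_gt0 ?exprn_gt0.
have mE : ((N * N.-1) ^ k)%:R = 2 * (2 ^+ k * X) :> R.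
  rewrite -[in LHS](bin1 N.-1) mul_bin_diag expnMn natrM natrX /X; by field.
rewrite powRD; last by rewrite (gt_eqF Y0) implybT.
rewrite powRr1 ?(ltW Y0) // powRM ?exprn_ge0 ?(ltW X0) //.
rewrite !mulrA ler_pM2r ?powR_gt0 // => bound.
by move: large; rewrite mE /X; lra.
Qed.
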